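(* Assume function extensionality, propositional truncations and excluded middle. If $A,B:\mathcal{U}$ are rigid types with $\neg(A\simeq B)$, then there is an automorphism $f:\mathcal{U}\to\mathcal{U}$ such that $f(A)\simeq B$.
   Context: Work in intensional Martin-Löf type theory with $\Pi$-, $\Sigma$-, identity, finite types and natural numbers, and a universe $\mathcal{U}$ closed under these, with propositional truncations $\|C\|$. A type is a proposition if any two elements are equal; a type $C$ is contractible if $\sum_{c:C}\prod_{c':C}(c=c')$. Excluded middle: for every proposition $P:\mathcal{U}$, $P+\neg P$. An equivalence is a map with a left and a right inverse; $C\simeq D$ means there is one; an automorphism of $\mathcal{U}$ is an equivalence $\mathcal{U}\to\mathcal{U}$. For $X:\mathcal{U}$, $\mathcal{U}_X:=\sum_{Z:\mathcal{U}}\|Z=X\|$, and $X$ is rigid if $\mathcal{U}_X$ is contractible. *)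

(* Defs.v *)
(* Everything below lives in the Prop-free fragment of Rocq (Pi, Sigma, +, *,
   the empty type and an inductive identity family), used as intensional
   Martin-Löf type theory; [eq] and [False], being in [Prop], are avoided. *)

(* An arbitrary universe. *)
Definition U := Type.

(* Identity types take values in [U], also those of [U] itself: this is what
   makes [Id Z X] for [Z X : U] an element of [U], hence in the scope of
   truncation and excluded middle, both of which are about [U].  Neither UIP
   for [Id] nor univalence of [U] is built in. *)
Inductive Id {A : Type} (x : A) : A -> U := idrefl : Id x x.

Definition Neg (C : Type) : Type := C -> Empty_set.

Definition isProp (P : U) : U := forall x y : P, Id x y.

Definition isContr (C : Type) : Type := {c : C & forall c' : C, Id c c'}.

Definition isEquiv {C D : Type} (f : C -> D) : Type :=
  ({g : D -> C & forall x : C, Id (g (f x)) x} *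
   {h : D -> C & forall y : D, Id (f (h y)) y})%type.

Definition Equiv (C D : Type) : Type := {f : C -> D & isEquiv f}.

Definition equiv_fun {C D : Type} (e : Equiv C D) : C -> D := projT1 e.

Definition FunExt : Type :=
  forall (A : U) (B : A -> U) (f g : forall x : A, B x),
    (forall x : A, Id (f x) (g x)) -> Id f g.

Definition ExcludedMiddle : Type := forall P : U, isProp P -> (P + Neg P)%type.

Record PropTrunc : Type := {
  Tr : U -> U;
  tr : forall C : U, C -> Tr C;
  Tr_isProp : forall C : U, isProp (Tr C);
  Tr_rec : forall C P : U, isProp P -> (C -> P) -> Tr C -> P
}.

(* The type of types merely equal to [X]. *)
Definition UAt (T : PropTrunc) (X : U) : Type := {Z : U & Tr T (Id Z X)}.

Definition isRigid (T : PropTrunc) (X : U) : Type := isContr (UAt T X).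

Definition Aut_U : Type := Equiv U U.

(* Main.v *)
(* By excluded middle, [U] is the disjoint sum of the types merely equal to [A],
   those merely equal to [B], and the rest.  Rigidity says that the first two
   parts are contractible, so exchanging [A] and [B] and fixing the rest is an
   involution of [U]. *)
Require Import Defs.

Lemma Id_sym {A : Type} {x y : A} (p : Id x y) : Id y x.
Proof. destruct p; exact (idrefl _). Defined.

Lemma Id_trans {A : Type} {x y z : A} (p : Id x y) (q : Id y z) : Id x z.
Proof. destruct q; exact p. Defined.

Lemma Id_map {A B : Type} (f : A -> B) {x y : A} (p : Id x y) : Id (f x) (f y).
Proof. destruct p; exact (idrefl _). Defined.

Lemma Equiv_refl (C : Type) : Equiv C C.
Proof.
  exists (fun c => c); split; exists (fun c => c); exact (fun c => idrefl c).
Defined.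

Lemma Equiv_of_Id {C D : U} (p : Id C D) : Equiv C D.
Proof. destruct p; exact (Equiv_refl C). Defined.

Lemma involution_isEquiv {C : Type} (f : C -> C)
    (ff : forall x : C, Id (f (f x)) x) : isEquiv f.
Proof. split; exists f; exact ff. Defined.

Lemma Empty_isProp : isProp Empty_set.
Proof. intros x; destruct x. Defined.

(** Contractibility of [UAt T X] identifies its points [(X, refl)] and [(Z, t)] through the centre;
    the first projection of that path is an untruncated identity. *)
Lemma rigid_Id (T : PropTrunc) (X : U) (rX : isRigid T X) (Z : U)
    (t : Tr T (Id Z X)) : Id X Z.
Proof.
  destruct rX as [c h].
  exact (Id_map (fun w : UAt T X => projT1 w)
           (Id_trans (Id_sym (h (existT _ X (tr T _ (idrefl X)))))
              (h (existT _ Z t)))).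
Defined.

(** The tests use truncated identities because [lem] decides only propositions, and [Id X A] need
    not be one. *)
Definition swap (T : PropTrunc) (lem : ExcludedMiddle) (A B X : U) : U :=
  match lem (Tr T (Id X A)) (Tr_isProp T _) with
  | inl _ => B
  | inr _ => match lem (Tr T (Id X B)) (Tr_isProp T _) with
             | inl _ => A
             | inr _ => X
             end
  end.

Lemma swap_l (T : PropTrunc) (lem : ExcludedMiddle) (A B : U) :
  Id (swap T lem A B A) B.
Proof.
  unfold swap.
  destruct (lem (Tr T (Id A A)) _) as [_ | n].
  - exact (idrefl _).
  - destruct (n (tr T _ (idrefl A))).
Defined.

(** Since [swap] tests against [A] first, [nBA] is what lets [B] reach the second test. *)
Lemma swap_r (T : PropTrunc) (lem : ExcludedMiddle) (A B : U)
    (nBA : Neg (Tr T (Id B A))) : Id (swap T lem A B B) A.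
Proof.
  unfold swap.
  destruct (lem (Tr T (Id B A)) _) as [t | _]; [destruct (nBA t) |].
  destruct (lem (Tr T (Id B B)) _) as [_ | n].
  - exact (idrefl _).
  - destruct (n (tr T _ (idrefl B))).
Defined.

Lemma swap_other (T : PropTrunc) (lem : ExcludedMiddle) (A B X : U)
    (nXA : Neg (Tr T (Id X A))) (nXB : Neg (Tr T (Id X B))) :
  Id (swap T lem A B X) X.
Proof.
  unfold swap.
  destruct (lem (Tr T (Id X A)) _) as [t | _]; [destruct (nXA t) |].
  destruct (lem (Tr T (Id X B)) _) as [t | _]; [destruct (nXB t) |].
  exact (idrefl _).
Defined.

Lemma swap_involutive (T : PropTrunc) (lem : ExcludedMiddle) (A B : U)
    (rA : isRigid T A) (rB : isRigid T B) (nBA : Neg (Tr T (Id B A))) (X : U) :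
  Id (swap T lem A B (swap T lem A B X)) X.
Proof.
  destruct (lem (Tr T (Id X A)) (Tr_isProp T _)) as [t | nXA].
  - destruct (rigid_Id T A rA X t).
    exact (Id_trans (Id_map (swap T lem A B) (swap_l T lem A B))
             (swap_r T lem A B nBA)).
  - destruct (lem (Tr T (Id X B)) (Tr_isProp T _)) as [t | nXB].
    + destruct (rigid_Id T B rB X t).
      exact (Id_trans (Id_map (swap T lem A B) (swap_r T lem A B nBA))
               (swap_l T lem A B)).
    + pose (p := swap_other T lem A B X nXA nXB).
      exact (Id_trans (Id_map (swap T lem A B) p) p).
Defined.

Theorem theorem3p3 (fe : FunExt) (T : PropTrunc) (lem : ExcludedMiddle)
    (A B : U) (rA : isRigid T A) (rB : isRigid T B) (nAB : Neg (Equiv A B)) :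
  {f : Aut_U & Equiv (equiv_fun f A) B}.
Proof.
  (* The empty type is a proposition, so refuting an actual identity refutes the truncated one;
     identical types are equivalent by transport, without univalence. *)
  assert (nBA : Neg (Tr T (Id B A))).
  { exact (Tr_rec T _ Empty_set Empty_isProp
             (fun p => nAB (Equiv_of_Id (Id_sym p)))). }
  exists (existT _ (swap T lem A B)
            (involution_isEquiv _ (swap_involutive T lem A B rA rB nBA))).
  exact (Equiv_of_Id (swap_l T lem A B)).
Qed.
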